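(* There is a universal constant $C>0$ with the following property. Suppose that $(\mathcal M,d_{\mathcal M})$ is a metric space and that $\mathcal C\ne\emptyset$ is a locally compact subset of $\mathcal M$. Then for every Banach space $(\mathbf Z,\|\cdot\|_{\mathbf Z})$ and every $L>0$, $$e(\mathcal M,\mathcal C;\mathbf Z)\le C\bigg(L+\sup_{\Delta>0}\mathrm{SEP}_\Delta\Big(B_{\mathcal M}\big(\mathcal C,\tfrac1L\Delta\big)\Big)\bigg).$$
   Context: For a metric space $(\mathcal M,d_{\mathcal M})$, a subset $\mathcal C\subseteq\mathcal M$ and a metric space $(\mathcal T,d_{\mathcal T})$, $e(\mathcal M,\mathcal C;\mathcal T)$ denotes the infimum over those $K>0$ such that every $f:\mathcal C\to\mathcal T$ has an extension $F:\mathcal M\to\mathcal T$ with $\|F\|_{\mathrm{Lip}(\mathcal M;\mathcal T)}\le K\|f\|_{\mathrm{Lip}(\mathcal C;\mathcal T)}$ (vacuous when $f$ is not Lipschitz), where $\|\cdot\|_{\mathrm{Lip}}$ is the Lipschitz constant; this is of interest when $|\mathcal C|\ge2$. For $r\ge0$, $B_{\mathcal M}(\mathcal C,r)=\bigcup_{x\in\mathcal C}B_{\mathcal M}(x,r)$, where $B_{\mathcal M}(x,r)=\{y: d_{\mathcal M}(x,y)\le r\}$; subsets carry the restricted metric. For a partition $\mathcal P$ of a metric space $(\mathcal N,d)$ and $x\in\mathcal N$, $\mathcal P(x)$ is the element of $\mathcal P$ containing $x$. A random partition $\mathcal P$ of $\mathcal N$ consists of a probability space $(\Omega,\mathbb P)$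 and set-valued maps $\Gamma^1,\Gamma^2,\ldots:\Omega\to2^{\mathcal N}$ that are strongly measurable (for every $i$ and every closed $E\subseteq\mathcal N$, $\{\omega: E\cap\Gamma^i(\omega)\ne\emptyset\}$ is $\mathbb P$-measurable) such that for every $\omega$, $\mathcal P^\omega=\{\Gamma^k(\omega)\}_{k\in\mathbb N}$ is a partition of $\mathcal N$ (empty clusters allowed). It is $\Delta$-bounded if $\mathrm{diam}_{\mathcal N}(\mathcal P^\omega(x))\le\Delta$ for all $\omega$, $x$. A $\Delta$-bounded random partition is $\sigma$-separating ($\sigma\ge0$) if $\mathbb P[\mathcal P(x)\ne\mathcal P(y)]\le\frac{\sigma}{\Delta}d(x,y)$ for all $x,y\in\mathcal N$. $\mathrm{SEP}_\Delta(\mathcal N)$ is the infimum over $\sigma\ge0$ such that there is a $\Delta$-bounded $\sigma$-separating random partition of $\mathcal N$ ($\infty$ if none exists). *)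

(* Defs.v *)
From HB Require Import structures.
From mathcomp Require Import all_boot all_order all_algebra.
From mathcomp Require Import all_classical all_reals all_analysis.

Set Implicit Arguments.
Unset Strict Implicit.
Unset Printing Implicit Defensive.

Import Order.TTheory GRing.Theory Num.Theory.
Import numFieldTopology.Exports numFieldNormedType.Exports.

Local Open Scope classical_set_scope.
Local Open Scope ring_scope.

Section subset_metric.
Context {R : realType} {M : metricType R} (A : set M).

Definition sub_mdist (x y : set_type A) : R := mdist (set_val x) (set_val y).

Fact sub_mdist_ge0 x y : 0 <= sub_mdist x y.
Proof. exact: mdist_ge0. Qed.

Fact sub_mdist_positivity x y : sub_mdist x y = 0 -> x = y.
Proof. by move=> /mdist_positivity/val_inj. Qed.

Fact sub_ballEmdist (x : set_type A) (r : R) :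
  ball x r = [set y | sub_mdist x y < r].
Proof.
have -> : ball x r = set_val @^-1` ball (set_val x) r by [].
by rewrite ballEmdist.
Qed.

HB.instance Definition _ := PseudoMetric_isMetric.Build R (set_type A)
  sub_mdist_ge0 sub_mdist_positivity sub_ballEmdist.

End subset_metric.

(* The library does not make a normed module a metric space canonically: this
   alias of Z carries the metric `|x - y|. *)
Definition norm_metric {R : realType} (Z : normedModType R) : Type := Z.

Section norm_metric.
Context {R : realType} (Z : normedModType R).

HB.instance Definition _ := PseudoMetric.copy (norm_metric Z) Z.

Definition norm_mdist (x y : norm_metric Z) : R := `|(x : Z) - (y : Z)|.

Fact norm_mdist_ge0 x y : 0 <= norm_mdist x y.
Proof. exact: normr_ge0. Qed.

Fact norm_mdist_positivity x y : norm_mdist x y = 0 -> x = y.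
Proof. by move=> /normr0_eq0/subr0_eq. Qed.

Fact norm_ballEmdist (x : norm_metric Z) (r : R) :
  ball x r = [set y | norm_mdist x y < r].
Proof.
have -> : ball x r = @ball R Z x r by [].
by rewrite -ball_normE.
Qed.

HB.instance Definition _ := PseudoMetric_isMetric.Build R (norm_metric Z)
  norm_mdist_ge0 norm_mdist_positivity norm_ballEmdist.

End norm_metric.

Section lipschitz_extension.
Context {R : realType}.

(* The Lipschitz constant; +oo when f is not Lipschitz. *)
Definition lip_const (M T : metricType R) (f : M -> T) : \bar R :=
  ereal_inf [set K%:E | K in [set K : R | 0 <= K /\
    forall x y, mdist (f x) (f y) <= K * mdist x y]].

(* e(M, A; T) *)
Definition ext_modulus (M : metricType R) (A : set M) (T : metricType R) :
    \bar R :=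
  ereal_inf [set K%:E | K in [set K : R | 0 < K /\
    forall f : set_type A -> T, (lip_const f < +oo)%E ->
      exists F : M -> T, (forall x : set_type A, F (set_val x) = f x) /\
        (lip_const F <= K%:E * lip_const f)%E]].

(* The union of the balls [set y | mdist x y <= r], for x in A; the library's
   closed_ball is the closure of the open ball, which can be smaller. *)
Definition closed_nbhd (M : metricType R) (A : set M) (r : R) : set M :=
  \bigcup_(x in A) [set y | mdist x y <= r].

End lipschitz_extension.

Section random_partition.
Context {R : realType} {N : metricType R}.

Definition diameter (A : set N) : \bar R :=
  ereal_sup [set (mdist x y)%:E | x in A & y in A].

Context {d : measure_display} {Omega : measurableType d}.

Definition strongly_measurable (Gamma : Omega -> set N) : Prop :=
  forall E : set N, closed E -> measurable [set w | E `&` Gamma w !=set0].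

Definition clusters (Gamma : nat -> Omega -> set N) (w : Omega) : set (set N) :=
  [set Gamma k w | k in [set: nat]].

(* The partition is the set of the clusters, so a cluster may be listed several
   times; the library's partition has nonempty parts, whence the removal of
   set0. *)
Definition random_partition (Gamma : nat -> Omega -> set N) : Prop :=
  (forall k, strongly_measurable (Gamma k)) /\
  (forall w, partition (clusters Gamma w `\ set0) id [set: N]).

Definition cluster_of (Gamma : nat -> Omega -> set N) (w : Omega) (x : N) :
  set N := pblock (clusters Gamma w) id x.

Definition bounded_partition (Delta : R) (Gamma : nat -> Omega -> set N) :
    Prop :=
  forall w x, (diameter (cluster_of Gamma w x) <= Delta%:E)%E.

Definition separating_partition (P : probability Omega R) (Delta sigma : R)
    (Gamma : nat -> Omega -> set N) : Prop :=
  forall x y, (P [set w | cluster_of Gamma w x <> cluster_of Gamma w y]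
               <= (sigma / Delta * mdist x y)%:E)%E.

End random_partition.

(* SEP_Delta(N) *)
Definition separation_modulus {R : realType} (Delta : R) (N : metricType R) :
    \bar R :=
  ereal_inf [set sigma%:E | sigma in [set sigma : R | 0 <= sigma /\
    exists (d : measure_display) (Omega : measurableType d)
      (P : probability Omega R) (Gamma : nat -> Omega -> set N),
      [/\ random_partition Gamma, bounded_partition Delta Gamma &
          separating_partition P Delta sigma Gamma]]].

(* Main.v *)
Require Import Defs.
From HB Require Import structures.
From mathcomp Require Import all_boot all_order all_algebra.
From mathcomp Require Import all_classical all_reals all_analysis.
From mathcomp Require Import ring lra.
Import Order.TTheory GRing.Theory Num.Theory.
Import numFieldTopology.Exports numFieldNormedType.Exports.

Local Open Scope classical_set_scope.
Local Open Scope ring_scope.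

(** Write [S] for the supremum of the separation moduli; only finite [S]
    matters, and when [A] has two distinct points [S >= 1/2], because every
    outcome separates them at each scale below their distance. Put [k = L + 1]
    and [sigma = S + 1], both at most a universal multiple of [L + S]. The
    constant of extension obtained is [44 k + 10 sigma].

    The extension of a [lam]-Lipschitz [f : A -> Z] at [x] is the mean of [f] at
    a random point of [A] whose distance to [x] is comparable to the distance
    from [x] to [A], and whose law is a Lipschitz function of [x] away from [A].

    At one scale [s > 0] ([scale_map]), take a [k s]-bounded
    [sigma]-separating random partition of the neighbourhood of [A]; it covers
    every point at distance less than [s] from [A]. Fix a sequence [c] of points
    of [A] which is an [s]-net of [A]; such a net exists because a single
    outcome of an [s]-bounded random partition covers [A] by countably many
    sets of diameter at most [s]. Send [x] to the mean [G s x] of [f (c n)],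
    where [n] is the first index such that the closed ball of radius [2 s]
    about [c n] meets the random cluster of [x]. This index is measurable, as
    the clusters are strongly measurable, and takes countably many values, so
    the mean is a series of vectors. The selected point lies within [3 k s] of
    [x], and the means at [x] and [y] differ only through the event that [x]
    and [y] are separated, whence a Lipschitz bound [10 sigma lam] at distances
    at most [s] ([net_mean_near], [net_mean_lip]).

    The scales are then glued ([glue_scales]): if [h] denotes the distance to
    [A] and [s <= h x < 2 s] with [s] a power of two, [F x] is the point of the
    segment from [G (2 s) x] to [G (4 s) x] with parameter [h x / s - 1]. This
    parameter moves by at most [d(x, y) / s], while the endpoints of the
    segment are at distance [O(lam k s)], which gives the Lipschitz bound for
    [x], [y] closer to each other than to [A]. In the remaining case
    the bound follows from [|F x - f c| <= 13 k lam d(x, c)] for [c] in [A].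
    On the closure of [A], [F] is the limit of [f]. *)

(** * Weighted series in a Banach space *)

Lemma norm_lim_le (R : realType) (Z : normedModType R) (u : Z^nat) (l : Z)
    (b : R) :
  u n @[n --> \oo] --> l -> (forall n, `|u n| <= b) -> `|l| <= b.
Proof.
by move=> ul ub; apply: (cvgr_to_le (cvg_norm ul)); apply: nearW.
Qed.

(** Weights [a] with sum [m] and absolute sum at most [t], on vectors at
    distance at most [r] from [z], give a sum within [r t] of [m z]. With
    [m = 1] this locates a mean; with [m = 0] it compares the means of two
    probability vectors. *)
Lemma weighted_series_near (R : realType) (Z : completeNormedModType R)
    (a : R^nat) (v : Z^nat) (z : Z) (r t m : R) :
    0 <= r ->
    (forall n, a n != 0 -> `|v n - z| <= r) ->
    (forall N, \sum_(0 <= i < N) `|a i| <= t) ->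
    series a n @[n --> \oo] --> m ->
  cvgn (series (fun n => a n *: v n)) /\
  `|limn (series (fun n => a n *: v n)) - m *: z| <= r * t.
Proof.
move=> r0 avr at_ am.
have avz n : `|a n *: (v n - z)| <= r * `|a n|.
  rewrite normrZ mulrC; have [->|/avr an] := eqVneq (a n) 0.
    by rewrite normr0 !mulr0.
  exact: ler_wpM2r.
have av n : `|a n *: v n| <= (r + `|z|) * `|a n|.
  have -> : a n *: v n = a n *: (v n - z) + a n *: z by rewrite -scalerDr subrK.
  by rewrite (le_trans (ler_normD _ _))// mulrDl lerD// normrZ mulrC.
have cv : cvgn (series (fun n => a n *: v n)).
  apply: normed_cvg; apply: nondecreasing_is_cvgn.
    apply/nondecreasing_seqP => n.
    by rewrite [leRHS]big_nat_recr//= lerDl.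
  exists ((r + `|z|) * t) => _ [n _ <-].
  apply: (@le_trans _ _ (\sum_(0 <= i < n) ((r + `|z|) * `|a i|))).
    by apply: ler_sum => i _; exact: av.
  by rewrite -mulr_sumr ler_wpM2l// addr_ge0.
split=> //.
apply: (@norm_lim_le _ _
  (fun n => series (fun n => a n *: v n) n - series a n *: z)).
  by apply: cvgB => //; apply: cvgZr_tmp.
move=> n.
have -> : series (fun n => a n *: v n) n - series a n *: z =
          \sum_(0 <= i < n) a i *: (v i - z).
  rewrite /series/= scaler_suml -sumrB.
  by apply: eq_bigr => i _; rewrite scalerBr.
rewrite (le_trans (ler_norm_sum _ _ _))//.
apply: (@le_trans _ _ (\sum_(0 <= i < n) (r * `|a i|))).
  by apply: ler_sum => i _; exact: avz.
by rewrite -mulr_sumr ler_wpM2l.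
Qed.

(** * Countable families of disjoint events *)

Lemma sum_prob_setI_le (R : realType) d (T : measurableType d)
    (P : probability T R) (E : (set T)^nat) (D : set T) (N : nat) :
    (forall n, measurable (E n)) -> trivIset setT E -> measurable D ->
  \sum_(0 <= i < N) fine (P (E i `&` D)) <= fine (P D).
Proof.
move=> mE tE mD.
have mED i : measurable (E i `&` D) by exact: measurableI.
rewrite -lee_fin fineK ?fin_num_measure// -sumEFin.
rewrite (eq_bigr (fun i => P (E i `&` D))); last first.
  by move=> i _; rewrite fineK// fin_num_measure.
rewrite big_mkord -(@measure_bigsetU _ _ _ P (fun i => E i `&` D))//;
  last exact: trivIset_setIr.
apply: le_measure; rewrite ?inE//; first exact: bigsetU_measurable.
by rewrite -(bigcup_mkord N (fun i => E i `&` D)) => w [i _ []].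
Qed.

(** The laws of two random indices which agree outside [D] are at distance at
    most [2 P(D)] in l^1. *)
Lemma sum_prob_dist (R : realType) d (T : measurableType d)
    (P : probability T R) (E F : (set T)^nat) (D : set T) (N : nat) :
    (forall n, measurable (E n)) -> trivIset setT E ->
    (forall n, measurable (F n)) -> trivIset setT F ->
    measurable D -> (forall n w, ~ D w -> E n w <-> F n w) ->
  \sum_(0 <= i < N) `|fine (P (E i)) - fine (P (F i))| <= 2 * fine (P D).
Proof.
move=> mE tE mF tF mD EF.
have split A : measurable A ->
    fine (P A) = fine (P (A `\` D)) + fine (P (A `&` D)).
  move=> mA; have mAD := measurableD mA mD; have mID := measurableI _ _ mA mD.
  rewrite -fineD ?fin_num_measure//; congr fine.
  rewrite -measureU//; last by rewrite -subset0 => w [[_ nD] [_ /nD]].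
  congr (P _); apply/seteqP; split=> [w Aw|w [[]|[]]//].
  by have [Dw|nDw] := pselect (D w); [right|left].
apply: (@le_trans _ _ (\sum_(0 <= i < N)
  (fine (P (E i `&` D)) + fine (P (F i `&` D))))).
  apply: ler_sum => i _; rewrite (split (E i))// (split (F i))//.
  have -> : E i `\` D = F i `\` D.
    by apply/seteqP; split=> w [EFi nD]; split=> //; apply/(EF i w nD).
  rewrite opprD addrACA subrr add0r (le_trans (ler_normB _ _))//.
  by rewrite !ger0_norm ?fine_ge0.
by rewrite big_split/= mulrDl !mul1r lerD// sum_prob_setI_le.
Qed.

Lemma series_prob (R : realType) d (T : measurableType d)
    (P : probability T R) (E : (set T)^nat) :
    (forall n, measurable (E n)) -> trivIset setT E ->
    \bigcup_n E n = setT ->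
  series (fun n => fine (P (E n))) n @[n --> \oo] --> (1 : R).
Proof.
move=> mE tE ET.
have : (\sum_(0 <= i < n) P (E i))%E @[n --> \oo] --> (1%:E : \bar R).
  rewrite -(@probability_setT _ _ _ P) -ET.
  by apply: measure_semi_sigma_additive => //; rewrite ET.
move/fine_cvg; apply: cvg_trans; apply: near_eq_cvg; apply: nearW => n /=.
rewrite /series/= (eq_bigr (fun i => (fine (P (E i)))%:E)) ?sumEFin//.
by move=> i _; rewrite fineK// fin_num_measure.
Qed.

(** * Distance to a set, and dyadic scales *)

Section distance_to_a_set.
Context {R : realType} {M : metricType R} (A : set M) (a0 : set_type A).

(** The distance from [x] to [A]; the infimum is over a nonempty set as soon as
    [A] is nonempty. *)
Definition dist_to (x : M) : R :=
  inf [set mdist x (set_val c) | c in [set: set_type A]].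

Lemma dist_to_le x (c : set_type A) : dist_to x <= mdist x (set_val c).
Proof.
by apply: ge_inf; [exists 0 => _ [c' _ <-]; exact: mdist_ge0|exists c].
Qed.

Lemma dist_to_adherent x (e : R) : 0 < e ->
  exists c : set_type A, mdist x (set_val c) < dist_to x + e.
Proof.
move=> e0; have [|_ [c _ <-] xc] := @inf_adherent R
    [set mdist x (set_val c) | c in [set: set_type A]] e e0; last by exists c.
split; first by exists (mdist x (set_val a0)), a0.
by exists 0 => _ [c' _ <-]; exact: mdist_ge0.
Qed.

Lemma dist_to_ge0 x : 0 <= dist_to x.
Proof.
apply: lb_le_inf; first by exists (mdist x (set_val a0)), a0.
by move=> _ [c _ <-]; exact: mdist_ge0.
Qed.

(** An affine bound in the distances to the points of [A] passes to the
    infimum. *)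
Lemma le_dist_to x (u a b : R) : 0 <= b ->
    (forall c : set_type A, u <= a + b * mdist x (set_val c)) ->
  u <= a + b * dist_to x.
Proof.
rewrite le_eqVlt => /predU1P[<- /(_ a0)|b0 ub]; first by rewrite !mul0r.
rewrite leNgt; apply/negP => hu.
have [|c] := @dist_to_adherent x ((u - a) / b - dist_to x).
  by rewrite subr_gt0 ltr_pdivlMr// ltrBrDl mulrC.
rewrite addrC subrK ltr_pdivlMr// ltrBrDl mulrC => /lt_le_trans/(_ (ub c)).
by rewrite ltxx.
Qed.

Lemma dist_to_lip x y : dist_to y <= dist_to x + mdist x y.
Proof.
rewrite addrC -[dist_to x]mul1r; apply: le_dist_to => // c.
rewrite mul1r (le_trans (dist_to_le y c))// (metric_sym x y).
exact: metric_triangle.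
Qed.

End distance_to_a_set.

(** Realized by the largest power of two at most [t]; the last clause says how
    it changes from one dyadic block to the next. *)
Lemma dyadic_scale (R : realType) : exists s : R -> R,
  (forall t, 0 < t -> [/\ 0 < s t, s t <= t & t < 2 * s t]) /\
  (forall t u, 0 < t ->
     (s t <= u < 2 * s t -> s u = s t) /\
     (2 * s t <= u < 2 * (2 * s t) -> s u = 2 * s t)).
Proof.
have l2 : 0 < ln (2 : R) by apply: ln_gt0; rewrite ltr1n.
pose S (k : int) := expR (k%:~R * ln 2) : R.
have S0 k : 0 < S k by exact: expR_gt0.
have SS k : 2 * S k = S (k + 1).
  have e : (k + 1)%:~R * ln 2 = k%:~R * ln 2 + ln 2 :> R.
    by rewrite intrD mulrDl mul1r.
  by rewrite /S e expRD lnK ?posrE// mulrC.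
pose K (t : R) : int := Num.floor (ln t / ln 2).
have Kdef t k : S k <= t < S (k + 1) -> K t = k.
  move=> /andP[kt tk]; have t0 := lt_le_trans (S0 k) kt.
  apply: floor_def; rewrite ler_pdivlMr// ltr_pdivrMr//.
  by rewrite -ler_expR -ltr_expR !lnK ?posrE// kt.
exists (S \o K); split=> [t t0|t u t0] /=.
  have /andP[Kt tK] := floor_itv (ln t / ln 2).
  rewrite SS; split=> //.
    by rewrite -{2}(@lnK _ t) ?posrE// ler_expR -ler_pdivlMr.
  by rewrite -{1}(@lnK _ t) ?posrE// ltr_expR -ltr_pdivrMr.
by rewrite !SS; split=> /Kdef ->.
Qed.

(** The value at a point of the closure of [A] of a Lipschitz map on [A]. *)
Lemma closure_value (R : realType) (M : metricType R) (A : set M)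
    (a0 : set_type A) (Z : completeNormedModType R) (f : set_type A -> Z)
    (lam : R) (x : M) :
    0 <= lam ->
    (forall a b, `|f a - f b| <= lam * mdist (set_val a) (set_val b)) ->
    dist_to A x = 0 ->
  exists z, forall c, `|z - f c| <= lam * mdist x (set_val c).
Proof.
move=> lam0 flip hx.
have e0 n : 0 < n.+1%:R^-1 :> R by rewrite invr_gt0.
have /choice[c cP] : forall n : nat, exists c : set_type A,
    mdist x (set_val c) < n.+1%:R^-1.
  by move=> n; have [c] := @dist_to_adherent _ _ _ a0 x _ (e0 n);
    rewrite hx add0r; exists c.
have cc n a : `|f (c n) - f a| <= lam * (n.+1%:R^-1 + mdist x (set_val a)).
  rewrite (le_trans (flip _ _))// ler_wpM2l//.
  rewrite (le_trans (metric_triangle _ x _))// lerD2r metric_sym ltW//.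
have cvf : cvgn (f \o c).
  apply/cauchy_cvgP/cauchy_exP => e e_gt0.
  have lam1 : 0 < 2 * (lam + 1) by rewrite mulr_gt0// ltr_wpDl.
  have el : 0 < e / (2 * (lam + 1)) by rewrite divr_gt0.
  have [N _ NP] := near_infty_natSinv_lt (PosNum el).
  exists (f (c N)), N => // n /= Nn.
  rewrite -ball_normE/= (le_lt_trans (cc _ _))//.
  have cN := NP N (leqnn N); have cn := ltW (cP n).
  have Nle : n.+1%:R^-1 <= N.+1%:R^-1 :> R by rewrite lef_pV2 ?posrE// ler_nat.
  apply: (@le_lt_trans _ _ (lam * (N.+1%:R^-1 + N.+1%:R^-1))).
    by rewrite ler_wpM2l// lerD// (le_trans cn).
  move: cN; rewrite /= ltr_pdivlMr//; have := e0 N.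
  move: (N.+1%:R^-1) => p p0 pe; lra.
exists (limn (f \o c)) => a.
apply/ler_addgt0Pr => e e_gt0.
have lam1 : 0 < lam + 1 by rewrite ltr_wpDl.
have el : 0 < e / (lam + 1) by rewrite divr_gt0.
apply: (@cvgr_to_le _ \oo _ _ (fun n => `|f (c n) - f a|)).
  by apply: cvg_norm; apply: cvgB => //; exact: cvg_cst.
have [N _ NP] := near_infty_natSinv_lt (PosNum el).
exists N => // n /= /NP /=; rewrite ltr_pdivlMr// => cn.
rewrite (le_trans (cc _ _))// mulrDr addrC lerD2l (le_trans _ (ltW cn))//.
by rewrite mulrC ler_wpM2l ?lerDl// ltW.
Qed.

(** * Gluing maps defined at all scales *)

Section segment.
Context {R : realType} {Z : normedModType R}.
Implicit Types (a b : R) (u v w t : Z).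

(** The point of parameter [a] on the segment from [u] to [v]. *)
Definition segment a u v : Z := (1 - a) *: u + a *: v.

Lemma segment0 u v : segment 0 u v = u.
Proof. by rewrite /segment subr0 scale1r scale0r addr0. Qed.

Lemma segment1 u v : segment 1 u v = v.
Proof. by rewrite /segment subrr scale1r scale0r add0r. Qed.

Lemma segmentxx a u : segment a u u = u.
Proof. by rewrite /segment -scalerDl subrK scale1r. Qed.

Lemma segment_dist_ends a u v w t (B : R) : 0 <= a <= 1 ->
  `|u - w| <= B -> `|v - t| <= B -> `|segment a u v - segment a w t| <= B.
Proof.
move=> /andP[a0 a1] uw vt; rewrite /segment opprD addrACA -!scalerBr.
rewrite (le_trans (ler_normD _ _))// !normrZ (ger0_norm a0).
rewrite ger0_norm ?subr_ge0//.
have -> : B = (1 - a) * B + a * B by rewrite -mulrDl subrK mul1r.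
by rewrite lerD// ler_wpM2l// subr_ge0.
Qed.

Lemma segment_dist_param a b u v :
  `|segment a u v - segment b u v| = `|a - b| * `|u - v|.
Proof.
rewrite /segment opprD addrACA -!scalerBl.
have -> : 1 - a - (1 - b) = - (a - b) by ring.
by rewrite scaleNr addrC -scalerBr normrZ distrC (distrC v).
Qed.

End segment.

(** Maps [G s], each controlled on the points at distance less than [s] from
    [A], are assembled into a Lipschitz extension of [f]. *)
Lemma glue_scales (R : realType) (M : metricType R) (A : set M)
    (a0 : set_type A) (Z : completeNormedModType R) (f : set_type A -> Z)
    (lam k sig : R) (G : R -> M -> Z) :
    0 <= lam -> 1 <= k -> 0 <= sig ->
    (forall a b, `|f a - f b| <= lam * mdist (set_val a) (set_val b)) ->
    (forall s x c, 0 < s -> dist_to A x < s ->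
      `|G s x - f c| <= lam * (3 * k * s + mdist x (set_val c))) ->
    (forall s x y, 0 < s -> dist_to A x < s -> dist_to A y < s ->
      mdist x y <= s -> `|G s x - G s y| <= 10 * sig * lam * mdist x y) ->
  exists F : M -> Z, (forall c, F (set_val c) = f c) /\
    (forall x y, `|F x - F y| <= lam * (44 * k + 10 * sig) * mdist x y).
Proof.
move=> lam0 k1 sig0 flip Gf Glip.
pose h := dist_to A; have h0 x : 0 <= h x by exact: dist_to_ge0.
have [s [sP s_eq]] := dyadic_scale R.
(* Both G t x and G (2 t) x are O(lam k t)-close to f at points of A near x. *)
have jump t x : 0 < t -> h x < t ->
    `|G t x - G (2 * t) x| <= lam * (11 * k) * t.
  move=> t0 hxt; have t20 : 0 < 2 * t by lra.
  have hx2t : h x < 2 * t by lra.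
  have : `|G t x - G (2 * t) x| <= lam * (9 * k * t) + (2 * lam) * h x.
    apply: le_dist_to => //; first by lra.
    move=> c.
    have -> : G t x - G (2 * t) x = (G t x - f c) - (G (2 * t) x - f c).
      by rewrite opprB addrA subrK.
    rewrite (le_trans (ler_normB _ _))//.
    rewrite (le_trans (lerD (Gf _ _ c t0 hxt) (Gf _ _ c t20 hx2t)))//.
    by rewrite le_eqVlt; apply/orP; left; apply/eqP; ring.
  move/le_trans; apply.
  have : lam * (2 * h x) <= lam * (2 * k * t).
    rewrite ler_wpM2l//; have := h0 x; nra.
  lra.
pose th x := h x / s (h x) - 1.
have [z zP] : exists z : M -> Z, forall x, h x = 0 ->
    forall c, `|z x - f c| <= lam * mdist x (set_val c).
  have /choice[z zP] : forall x, exists z : Z, h x = 0 ->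
      forall c, `|z - f c| <= lam * mdist x (set_val c).
    move=> x; have [hx|hx] := eqVneq (h x) 0; last first.
      by exists 0 => hx0; rewrite hx0 eqxx in hx.
    have [z zP] := @closure_value _ _ _ a0 _ f lam x lam0 flip hx.
    by exists z.
  by exists z.
pose F x := if h x == 0 then z x else
  segment (th x) (G (2 * s (h x)) x) (G (2 * (2 * s (h x))) x).
have th01 x : 0 < h x -> 0 <= th x <= 1.
  move=> /sP[s0 sh hs]; rewrite subr_ge0 ler_pdivlMr// mul1r sh/=.
  by rewrite lerBlDr ler_pdivrMr// ltW.
(* F x is near f: this governs the pairs at least as far apart as h x. *)
have Fnear x c : `|F x - f c| <= lam * (13 * k) * mdist x (set_val c).
  have d0 := mdist_ge0 x (set_val c).
  rewrite /F; case: ifPn => [/eqP hx|hx].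
    rewrite (le_trans (zP _ hx c))// ler_wpM2r//; nra.
  have hx0 : 0 < h x by rewrite lt_neqAle eq_sym hx h0.
  have hd : h x <= mdist x (set_val c) by exact: dist_to_le.
  have [s0 sh hs] := sP _ hx0.
  have s20 : 0 < 2 * s (h x) by lra.
  have s40 : 0 < 2 * (2 * s (h x)) by lra.
  have h4 : h x < 2 * (2 * s (h x)) by lra.
  have G2 := Gf _ _ c s20 hs; have G4 := Gf _ _ c s40 h4.
  rewrite -(segmentxx (th x) (f c)); apply: segment_dist_ends.
  - exact: th01.
  - rewrite (le_trans G2)// -[leRHS]mulrA ler_wpM2l//.
    move: (mdist _ _) hd d0 => D hd d0; move: (s _) s0 sh => S S0 Sh; nra.
  - rewrite (le_trans G4)// -[leRHS]mulrA ler_wpM2l//.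
    move: (mdist _ _) hd d0 => D hd d0; move: (s _) s0 sh => S S0 Sh; nra.
(* Moving the parameter along one segment. *)
have slide a b t x d : 0 < t -> h x < 2 * t -> `|a - b| <= d / t ->
    `|segment a (G (2 * t) x) (G (2 * (2 * t)) x) -
      segment b (G (2 * t) x) (G (2 * (2 * t)) x)| <= lam * (22 * k) * d.
  move=> t0 hx ab; have t20 : 0 < 2 * t by lra.
  rewrite segment_dist_param.
  apply: (le_trans (ler_pM (normr_ge0 _) (normr_ge0 _) ab (jump _ _ t20 hx))).
  by rewrite le_eqVlt; apply/orP; left; apply/eqP; field; rewrite gt_eqF.
(* When d(x, y) < h x <= h y, x and y lie in the same dyadic block or in two
   consecutive ones. *)
have Fclose x y : h x <= h y -> mdist x y < h x ->
    `|F x - F y| <= lam * (44 * k + 10 * sig) * mdist x y.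
  move=> hxy dh; have d0 := mdist_ge0 x y.
  have hx0 : 0 < h x by exact: le_lt_trans dh.
  have hy0 : 0 < h y by exact: lt_le_trans hxy.
  have hyd : h y <= h x + mdist x y by exact: dist_to_lip.
  have [s0 sh hs] := sP _ hx0.
  have [sxy sxy2] := s_eq _ (h y) hx0.
  have thx := th01 _ hx0.
  have thxE : th x = h x / s (h x) - 1 by [].
  have thyE : th y = h y / s (h y) - 1 by [].
  set d := mdist x y in dh hyd d0 *.
  have lkd0 : 0 <= lam * k * d by rewrite !mulr_ge0//; lra.
  set S := s (h x) in s0 sh hs sxy sxy2 thxE *.
  have s20 : 0 < 2 * S by lra.
  have s40 : 0 < 2 * (2 * S) by lra.
  have x4 : h x < 2 * (2 * S) by lra.
  have y4 : h y < 2 * (2 * S) by lra.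
  have d4 : d <= 2 * (2 * S) by lra.
  have G4 := Glip _ x y s40 x4 y4 d4; rewrite -/d in G4.
  rewrite /F !gt_eqF// -/S; have [ylt|yge] := ltP (h y) (2 * S).
    have sy : s (h y) = S by apply: sxy; rewrite (le_trans sh hxy).
    rewrite sy in thyE *.
    have d2 : d <= 2 * S by lra.
    have G2 := Glip _ x y s20 hs ylt d2; rewrite -/d in G2.
    (* Same block: compare both with the point at y of the parameter of x. *)
    have e1 := segment_dist_ends _ _ _ _ _ _ thx G2 G4.
    have /(slide _ _ _ _ _ s0 ylt) e2 : `|th x - th y| <= d / S.
      have -> : th x - th y = - ((h y - h x) / S).
        by rewrite thxE thyE; ring.
      rewrite normrN ger0_norm ?divr_ge0 ?subr_ge0 ?(ltW s0)//.
      by rewrite ler_pM2r ?invr_gt0// lerBlDl.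
    apply: le_trans (ler_distD _ _ _) _.
    by apply: le_trans (lerD e1 e2) _; lra.
  (* Consecutive blocks: both segments have an endpoint at scale 4 S. *)
  have sy : s (h y) = 2 * S by apply: sxy2; rewrite yge.
  rewrite sy in thyE *.
  have /(slide _ _ _ _ _ s0 hs) e1 : `|th x - 1| <= d / S.
    have -> : th x - 1 = - ((2 * S - h x) / S).
      by rewrite thxE; field; rewrite gt_eqF.
    rewrite normrN ger0_norm ?divr_ge0 ?subr_ge0 ?(ltW s0) ?(ltW hs)//.
    by rewrite ler_pM2r ?invr_gt0// lerBlDl; lra.
  have /(slide _ _ _ _ _ s20 y4) e2 : `|0 - th y| <= d / (2 * S).
    have -> : 0 - th y = - ((h y - 2 * S) / (2 * S)).
      by rewrite thyE; field; rewrite gt_eqF.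
    rewrite normrN ger0_norm ?divr_ge0 ?subr_ge0 ?(ltW s20)//.
    by rewrite ler_pM2r ?invr_gt0// lerBlDl; lra.
  rewrite segment1 in e1; rewrite segment0 in e2.
  apply: le_trans (ler_distD _ _ _) _.
  apply: le_trans (lerD e1 (ler_distD _ _ _)) _.
  by apply: le_trans (lerD (lexx _) (lerD G4 e2)) _; lra.
have Flip x y : h x <= h y ->
    `|F x - F y| <= lam * (44 * k + 10 * sig) * mdist x y.
  move=> hxy; have [hd|/Fclose] := leP (h x) (mdist x y); last exact.
  have d0 := mdist_ge0 x y.
  (* The bound through c in A, then the infimum over c. *)
  have : `|F x - F y| <=
      lam * (13 * k) * mdist x y + 2 * (lam * (13 * k)) * h x.
    apply: le_dist_to => //; first by nra.
    move=> c; have -> : F x - F y = (F x - f c) - (F y - f c).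
      by rewrite opprB addrA subrK.
    rewrite (le_trans (ler_normB _ _))//.
    rewrite (le_trans (lerD (Fnear x c) (Fnear y c)))//.
    have tri : mdist y (set_val c) <= mdist x y + mdist x (set_val c).
      by rewrite (metric_sym x y); exact: metric_triangle.
    have : lam * (13 * k) * mdist y (set_val c) <=
        lam * (13 * k) * (mdist x y + mdist x (set_val c)).
      by rewrite ler_wpM2l// mulr_ge0//; lra.
    lra.
  move=> /le_trans; apply.
  have : lam * (13 * k) * h x <= lam * (13 * k) * mdist x y.
    by rewrite ler_wpM2l// mulr_ge0//; lra.
  have : 0 <= lam * mdist x y by rewrite mulr_ge0.
  move: (mdist x y) (h x) d0 {hd} => d hx d0 ? ?; nra.
exists F; split=> [c|x y].
  apply/eqP; rewrite -subr_eq0 -normr_le0.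
  by rewrite (le_trans (Fnear _ c))// mdistxx mulr0.
have [|/ltW] := leP (h x) (h y); first exact: Flip.
by rewrite distrC metric_sym; exact: Flip.
Qed.

(** * Clusters of a random partition *)

Lemma closed_mdist_ball (R : realType) (N : metricType R) (x : N) (r : R) :
  closed [set y | mdist x y <= r].
Proof.
rewrite -[X in closed X]setCK; apply: open_closedC.
rewrite openE => y /= /negP; rewrite -ltNge => ry.
have e0 : 0 < mdist x y - r by rewrite subr_gt0.
apply/nbhs_ballP; exists (mdist x y - r) => //= u.
rewrite ballEmdist/= => yu; apply/negP; rewrite -ltNge.
have := metric_triangle x u y; rewrite (metric_sym u y).
by rewrite -subr_gt0 in yu; lra.
Qed.

Section random_partition_clusters.
Context {R : realType} {N : metricType R} {d : measure_display}
  {Omega : measurableType d} (Gamma : nat -> Omega -> set N).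
Hypothesis rG : random_partition Gamma.

Lemma random_partition_cover w x : exists k, Gamma k w x.
Proof.
have [cov _ _] := rG.2 w.
have : [set: N] x by [].
rewrite -cov => -[C [[k _ <-] _] Cx].
by exists k.
Qed.

Lemma cluster_ofE k w x : Gamma k w x -> cluster_of Gamma w x = Gamma k w.
Proof.
move=> kx; have [_ tri _] := rG.2 w.
rewrite /cluster_of /pblock /pblock_index.
have CG : clusters Gamma w (Gamma k w) by rewrite /clusters /=; exists k.
have PG : (clusters Gamma w `\ set0) (Gamma k w).
  by split=> //= G0; rewrite G0 in kx.
have [|CC Cx] := @getPex (set N : pointedType)
  (fun C : set N => clusters Gamma w C /\ C x); first by exists (Gamma k w).
by apply: tri => //; [split=> //= C0; rewrite C0 in Cx|exists x].
Qed.

Lemma cluster_of_self w x : cluster_of Gamma w x x.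
Proof.
have [k kx] := random_partition_cover w x.
by rewrite (cluster_ofE _ _ _ kx).
Qed.

(** Strong measurability is used on the closed set [{x}]. *)
Lemma measurable_mem k x : measurable [set w | Gamma k w x].
Proof.
have := (rG.1 k) _ (closed_mdist_ball _ _ x 0); congr measurable.
apply/seteqP; split=> w /=; last first.
  by exists x => //=; split=> //=; rewrite mdistxx.
move=> [y [/= xy]]; suff -> : x = y by [].
by apply: mdist_positivity; apply/eqP; rewrite eq_le xy mdist_ge0.
Qed.

Lemma measurable_cluster_meets (E : set N) x : closed E ->
  measurable [set w | E `&` cluster_of Gamma w x !=set0].
Proof.
move=> cE.
have -> : [set w | E `&` cluster_of Gamma w x !=set0] =
    \bigcup_k ([set w | Gamma k w x] `&` [set w | E `&` Gamma k w !=set0]).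
  apply/seteqP; split=> w /=.
    have [k kx] := random_partition_cover w x.
    by rewrite (cluster_ofE _ _ _ kx) => Ek; exists k.
  by move=> [k _ [/= kx Ek]]; rewrite (cluster_ofE _ _ _ kx).
apply: bigcupT_measurable => k; apply: measurableI; first exact: measurable_mem.
exact: rG.1.
Qed.

Lemma measurable_separated x y :
  measurable [set w | cluster_of Gamma w x <> cluster_of Gamma w y].
Proof.
have -> : [set w | cluster_of Gamma w x <> cluster_of Gamma w y] =
    ~` \bigcup_k ([set w | Gamma k w x] `&` [set w | Gamma k w y]).
  apply/seteqP; split=> w /=.
    by apply: contra_not => -[k _ [/= kx ky]];
      rewrite (cluster_ofE _ _ _ kx) (cluster_ofE _ _ _ ky).
  apply: contra_not => xy; have [k kx] := random_partition_cover w x.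
  exists k => //; split=> //=.
  by rewrite -(cluster_ofE _ _ _ kx) xy; exact: cluster_of_self.
apply: measurableC; apply: bigcupT_measurable => k.
by apply: measurableI; exact: measurable_mem.
Qed.

Lemma mdist_cluster Delta w x y : bounded_partition Delta Gamma ->
  cluster_of Gamma w x y -> mdist x y <= Delta.
Proof.
move=> bG xy; rewrite -lee_fin; apply: le_trans (bG w x).
by apply: ereal_sup_ubound; exists x; [exact: cluster_of_self|exists y].
Qed.

Variables (c : nat -> N) (r : R).

Let meets (x : N) (n : nat) : set Omega :=
  [set w | [set y | mdist (c n) y <= r] `&` cluster_of Gamma w x !=set0].

(** [first_near x n] is the event that [n] is the first index for which the
    closed ball of radius [r] about [c n] meets the cluster of [x]. *)
Definition first_near (x : N) : (set Omega)^nat := seqDU (meets x).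

Lemma measurable_first_near x n : measurable (first_near x n).
Proof.
apply: measurableD; last apply: bigsetU_measurable => i _.
  by apply: measurable_cluster_meets; exact: closed_mdist_ball.
by apply: measurable_cluster_meets; exact: closed_mdist_ball.
Qed.

Lemma first_near_cover x :
  (exists n, mdist (c n) x <= r) -> \bigcup_n first_near x n = setT.
Proof.
move=> [n cx]; rewrite -seqDU_bigcup_eq -subTset => w _; exists n => //=.
by exists x; split=> //; exact: cluster_of_self.
Qed.

Lemma first_near_dist Delta x n w : bounded_partition Delta Gamma ->
  first_near x n w -> mdist x (c n) <= Delta + r.
Proof.
move=> bG [[y [/= cy xy]] _]; rewrite (le_trans (metric_triangle _ y _))//.
by rewrite lerD ?(mdist_cluster _ _ _ _ bG xy)// metric_sym.
Qed.

Lemma first_near_eq x y n w : cluster_of Gamma w x = cluster_of Gamma w y ->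
  first_near x n w <-> first_near y n w.
Proof.
move=> xy; have e m : meets x m w = meets y m w by rewrite /meets /= xy.
rewrite /first_near /seqDU -(bigcup_mkord n (meets x)).
rewrite -(bigcup_mkord n (meets y)) /= e.
by split=> -[my nm]; split=> // -[i ni mi]; apply: nm; exists i => //;
  rewrite ?e // -e.
Qed.

End random_partition_clusters.

(** * Averaging over a net of points *)

Section mean_over_net.
Context {R : realType} {N : metricType R} {d : measure_display}
  {Omega : measurableType d} (P : probability Omega R)
  (Gamma : nat -> Omega -> set N) (Delta sigma r : R) (c : nat -> N)
  (Z : completeNormedModType R) (v : nat -> Z).
Hypothesis rG : random_partition Gamma.
Hypothesis bG : bounded_partition Delta Gamma.
Hypothesis sG : separating_partition P Delta sigma Gamma.

Let covered (x : N) : Prop := exists n, mdist (c n) x <= r.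

Let p x n : R := fine (P (first_near Gamma c r x n)).

(** The mean of [v n], [n] being the random index of the first [c n] near the
    cluster of [x]. It is a genuine mean when some [c n] is within [r] of [x],
    as the index is then always defined. *)
Definition net_mean (x : N) : Z := limn (series (fun n => p x n *: v n)).

Let p_neq0 x n : p x n != 0 -> mdist x (c n) <= Delta + r.
Proof.
move=> px; have [e|/set0P[w]] := eqVneq (first_near Gamma c r x n) set0.
  by rewrite /p e measure0 eqxx in px.
exact: first_near_dist.
Qed.

Let mE := measurable_first_near _ rG c r.

Let p_series x : covered x -> series (p x) n @[n --> \oo] --> (1 : R).
Proof.
move=> cx.
apply: series_prob; first exact: mE.
  exact: trivIset_seqDU.
exact: first_near_cover.
Qed.

Let p_norm x n : \sum_(0 <= i < n) `|p x i| <= 1.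
Proof.
have -> : 1 = fine (P [set: Omega]) by rewrite probability_setT.
have := sum_prob_setI_le _ _ _ P (first_near Gamma c r x) setT n (mE x)
  (trivIset_seqDU _) measurableT.
apply: le_trans; apply: ler_sum => i _.
by rewrite setIT ger0_norm// fine_ge0.
Qed.

Lemma net_mean_near x z rho : covered x -> 0 <= rho ->
    (forall n, mdist x (c n) <= Delta + r -> `|v n - z| <= rho) ->
  `|net_mean x - z| <= rho.
Proof.
move=> cx rho0 vz; have [n pn|_] := weighted_series_near _ _ (p x) v z rho 1 1
  rho0 _ (p_norm x) (p_series x cx); first exact: vz (p_neq0 _ _ pn).
by rewrite scale1r mulr1.
Qed.

Lemma net_mean_lip x y z rho : covered x -> covered y -> 0 <= rho ->
    (forall n, mdist x (c n) <= Delta + r \/ mdist y (c n) <= Delta + r ->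
      `|v n - z| <= rho) ->
  `|net_mean x - net_mean y| <= rho * (2 * (sigma / Delta * mdist x y)).
Proof.
move=> cx cy rho0 vz.
have cvx u : covered u ->
    (forall n, mdist u (c n) <= Delta + r -> `|v n - z| <= rho) ->
    cvgn (series (fun n => p u n *: v n)).
  move=> cu vu; have [n pn|//] := weighted_series_near _ _ (p u) v z rho 1 1
    rho0 _ (p_norm u) (p_series u cu); exact: vu (p_neq0 _ _ pn).
have mD := measurable_separated _ rG x y.
set D := [set w | _] in mD.
have PD : fine (P D) <= sigma / Delta * mdist x y.
  by rewrite -lee_fin fineK ?fin_num_measure//; exact: sG.
have pD n : \sum_(0 <= i < n) `|p x i - p y i| <=
    2 * (sigma / Delta * mdist x y).
  apply: le_trans (_ : 2 * fine (P D) <= _); last by rewrite ler_wpM2l.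
  apply: sum_prob_dist; rewrite ?mE//; try exact: trivIset_seqDU.
  by move=> m w /contrapT; exact: first_near_eq.
have p0 : series (fun n => p x n - p y n) n @[n --> \oo] --> (0 : R).
  have -> : series (fun n => p x n - p y n) = series (p x) \- series (p y).
    by apply/funext => n; rewrite /series/= sumrB.
  by rewrite -(subrr 1); apply: cvgB; exact: p_series.
have [n|_] := weighted_series_near _ _ _ v z rho _ 0 rho0 _ pD p0.
  move=> pxy; apply: vz; have [px|/p_neq0] := eqVneq (p x n) 0; last by left.
  by right; apply: p_neq0; move: pxy; rewrite px sub0r oppr_eq0.
rewrite scale0r subr0; apply: le_trans.
have -> : series (fun n => (p x n - p y n) *: v n) =
    series (fun n => p x n *: v n) \- series (fun n => p y n *: v n).
  apply/funext => n; rewrite /series/= -sumrB.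
  by apply: eq_bigr => i _; rewrite scalerBl.
by rewrite limB //; apply: cvx => // n xn; apply: vz; [left|right].
Qed.

End mean_over_net.

(** * The map at one scale *)

(** There is a [Delta]-bounded [sigma]-separating random partition of [N]. *)
Definition has_separating_partition {R : realType} (Delta sigma : R)
    (N : metricType R) : Prop :=
  exists (d : measure_display) (Omega : measurableType d)
    (P : probability Omega R) (Gamma : nat -> Omega -> set N),
    [/\ random_partition Gamma, bounded_partition Delta Gamma &
        separating_partition P Delta sigma Gamma].

Lemma probability_inhabited (R : realType) d (Omega : measurableType d)
  (P : probability Omega R) : inhabited Omega.
Proof.
have : [set: Omega] !=set0.
  apply/set0P/eqP => O0; have := @probability_setT _ _ _ P.
  by rewrite O0 measure0 => /esym/eqP; rewrite onee_eq0.
by move=> [w _].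
Qed.

Section scale_map.
Context {R : realType} {M : metricType R} (A : set M) (a0 : set_type A).
Variables (L sigma : R).
Hypothesis L0 : 0 < L.
Hypothesis sepA : forall Delta, 0 < Delta ->
  has_separating_partition Delta sigma
    (set_type (closed_nbhd A (L^-1 * Delta))).

Lemma mem_closed_nbhd (r : R) (a : set_type A) x :
  mdist x (set_val a) <= r -> closed_nbhd A r x.
Proof.
by move=> xa; exists (set_val a); [exact: set_valP|rewrite /= metric_sym].
Qed.

(** The nonempty traces on [A] of the clusters of one outcome of an [s]-bounded
    random partition have diameter at most [s]; one point is chosen in each. *)
Lemma countable_net (s : R) : 0 < s -> exists c : nat -> set_type A,
  forall a : set_type A, exists n, mdist (set_val (c n)) (set_val a) <= s.
Proof.
move=> s0; have [d [T [P [Gamma [rG bG sG]]]]] := sepA s s0.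
have [w] := probability_inhabited _ _ _ P.
have /choice[c cP] : forall k, exists c : set_type A,
    (exists2 u, Gamma k w u & set_val u = set_val c) \/
    (forall (a : set_type A) u, Gamma k w u -> set_val u <> set_val a).
  move=> k; have [[a au]|na] := pselect (exists a : set_type A,
    exists2 u, Gamma k w u & set_val u = set_val a); first by exists a; left.
  by exists a0; right=> a u ku ua; apply: na; exists a, u.
exists c => a.
have aN : closed_nbhd A (L^-1 * s) (set_val a).
  by apply: (@mem_closed_nbhd _ a); rewrite mdistxx mulr_ge0// ?invr_ge0 ltW.
pose u : set_type (closed_nbhd A (L^-1 * s)) := SigSub (mem_set aN).
(* The chosen point of the cluster of a is within s of a. *)
have [k ku] := random_partition_cover _ rG w u; exists k.
have [[u' ku' <-]|/(_ a u ku)] := cP k; last by [].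
apply: (mdist_cluster _ rG _ w u' u bG).
by rewrite (cluster_ofE _ rG _ _ _ ku').
Qed.

(** The partition is taken at the scale [Delta = k s]; since [L <= k], the
    neighbourhood of radius [Delta / L] contains all points at distance less
    than [s] from [A], and [1 <= k] makes the net radius [s] at most [Delta]. *)
Lemma scale_map (Z : completeNormedModType R) (f : set_type A -> Z)
    (lam k s : R) :
    0 <= lam -> 1 <= k -> L <= k -> 0 <= sigma -> 0 < s ->
    (forall a b, `|f a - f b| <= lam * mdist (set_val a) (set_val b)) ->
  exists G : M -> Z,
    (forall x c, dist_to A x < s ->
      `|G x - f c| <= lam * (3 * k * s + mdist x (set_val c))) /\
    (forall x y, dist_to A x < s -> dist_to A y < s ->
      mdist x y <= s -> `|G x - G y| <= 10 * sigma * lam * mdist x y).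
Proof.
move=> lam0 k1 Lk sigma0 s0 flip.
have ks0 : 0 < k * s by rewrite mulr_gt0//; lra.
have sks : s <= k * s by rewrite -[leLHS]mul1r ler_wpM2r// ltW.
have [c cs] := countable_net s s0.
have [d [T [P [Gamma [rG bG sG]]]]] := sepA _ ks0.
set r := L^-1 * (k * s) in Gamma rG bG sG.
have sr : s <= r by rewrite /r ler_pdivlMl// ler_wpM2r// ltW.
have cN n : closed_nbhd A r (set_val (c n)).
  by apply: (mem_closed_nbhd _ (c n)); rewrite mdistxx; lra.
pose c' n : set_type (closed_nbhd A r) := SigSub (mem_set (cN n)).
have nearA x : dist_to A x < s ->
    exists a : set_type A, mdist x (set_val a) < s.
  move=> hx; have [|a] := dist_to_adherent A a0 x (s - dist_to A x).
    by rewrite subr_gt0.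
  by rewrite addrC subrK => xa; exists a.
(* i is the inclusion in the neighbourhood of A, with a junk value outside. *)
have /choice[i iE] : forall x, exists u : set_type (closed_nbhd A r),
    dist_to A x < s -> set_val u = x.
  move=> x; have [/nearA[a xa]|_] := ltP (dist_to A x) s; last first.
    by exists (c' 0%N).
  have xN : closed_nbhd A r x by apply: (mem_closed_nbhd _ a); lra.
  by exists (SigSub (mem_set xN)).
have covered x : dist_to A x < s -> exists n, mdist (c' n) (i x) <= 2 * s.
  move=> hx; have [a xa] := nearA _ hx; have [n cn] := cs a; exists n.
  have -> : mdist (c' n) (i x) = mdist (set_val (c n)) x.
    by rewrite -{2}(iE x hx).
  by have := metric_triangle (set_val (c n)) (set_val a) x;
    rewrite (metric_sym (set_val a) x); lra.
have mdist_i x n : dist_to A x < s ->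
    mdist (i x) (c' n) = mdist x (set_val (c n)).
  by move=> hx; rewrite -{2}(iE x hx).
exists (fun x => net_mean P Gamma (2 * s) c' Z (f \o c) (i x)); split.
  move=> x a hx; apply: (net_mean_near _ _ (k * s)) => //; first exact: covered.
    by rewrite mulr_ge0// addr_ge0 ?mdist_ge0//; lra.
  move=> n; rewrite mdist_i// => xn.
  rewrite (le_trans (flip _ _))// ler_wpM2l//.
  rewrite (le_trans (metric_triangle _ x _))// lerD2r metric_sym; lra.
move=> x y hx hy xys; have [a xa] := nearA _ hx.
(* All net points selected at x or y are within k s + 4 s <= 5 k s of a. *)
have := net_mean_lip P Gamma (k * s) sigma (2 * s) c' Z (f \o c) rG bG sG
  (i x) (i y) (f a) (lam * (5 * (k * s))) (covered _ hx) (covered _ hy).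
have -> : mdist (i x) (i y) = mdist x y by rewrite -{2}(iE x hx) -{2}(iE y hy).
move=> H; apply: (le_trans (H _ _)).
- by rewrite mulr_ge0//; lra.
- move=> n; rewrite !mdist_i// => xyn.
  rewrite (le_trans (flip _ _))// ler_wpM2l//.
  rewrite (le_trans (metric_triangle _ x _))// (metric_sym (set_val (c n))).
  case: xyn => [|yn]; first lra.
  have := metric_triangle x y (set_val (c n)); lra.
- rewrite le_eqVlt; apply/orP; left; apply/eqP; field.
  by rewrite !gt_eqF//; lra.
Qed.

End scale_map.

(** * Lipschitz constants and moduli *)

Section moduli.
Context {R : realType}.

Lemma lip_const_ge0 (M T : metricType R) (f : M -> T) : (0 <= lip_const f)%E.
Proof. by apply: le_ereal_inf_tmp => _ [K [K0 _] <-]; rewrite lee_fin. Qed.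

Lemma lip_const_le (M T : metricType R) (f : M -> T) (K : R) : 0 <= K ->
  (forall x y, mdist (f x) (f y) <= K * mdist x y) -> (lip_const f <= K%:E)%E.
Proof. by move=> K0 fK; apply: ereal_inf_lbound; exists K. Qed.

(** The infimum defining the Lipschitz constant is attained. *)
Lemma lip_constP (M T : metricType R) (f : M -> T) (lam : R) :
  lip_const f = lam%:E -> forall x y, mdist (f x) (f y) <= lam * mdist x y.
Proof.
move=> flam x y; apply/ler_addgt0Pr => e e0.
have d1 : 0 < mdist x y + 1 by rewrite ltr_wpDl ?mdist_ge0.
have [|_ [K [K0 fK] <-]] := @ereal_inf_lt _
    [set K%:E | K in [set K : R | 0 <= K /\
      forall x y, mdist (f x) (f y) <= K * mdist x y]]
    (lam + e / (mdist x y + 1))%:E.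
  by rewrite -/(lip_const f) flam lte_fin ltrDl divr_gt0.
rewrite lte_fin => /ltW Klam; apply: (le_trans (fK x y)).
apply: (le_trans (ler_wpM2r (mdist_ge0 x y) Klam)).
rewrite mulrDl lerD2l mulrAC ler_pdivrMr// ler_wpM2l ?ltW//.
by rewrite ltrDl.
Qed.

Lemma separation_modulus_ge0 (Delta : R) (N : metricType R) :
  (0 <= separation_modulus Delta N)%E.
Proof. by apply: le_ereal_inf_tmp => _ [K [K0 _] <-]; rewrite lee_fin. Qed.

Lemma separation_modulus_lt (Delta sigma : R) (N : metricType R) :
    0 < Delta -> (separation_modulus Delta N < sigma%:E)%E ->
  has_separating_partition Delta sigma N.
Proof.
move=> D0 /ereal_inf_lt[_ [t [t0 [d [T [P [Gamma [rG bG sG]]]]]] <-]].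
rewrite lte_fin => ts; exists d, T, P, Gamma; split=> // x y.
apply: (le_trans (sG x y)); rewrite lee_fin ler_wpM2r ?mdist_ge0//.
by rewrite ler_pM2r ?invr_gt0// ltW.
Qed.

(** Points further apart than [Delta] are separated by every outcome. *)
Lemma separating_ge (Delta sigma : R) (N : metricType R) (x y : N) :
    0 < Delta < mdist x y -> has_separating_partition Delta sigma N ->
  1 <= sigma / Delta * mdist x y.
Proof.
move=> /andP[D0 Dxy] [d [T [P [Gamma [rG bG sG]]]]].
rewrite -lee_fin; apply: le_trans (sG x y).
rewrite -(@probability_setT _ _ _ P).
rewrite le_eqVlt; apply/orP; left; apply/eqP; congr (P _).
apply/seteqP; split=> // w _ /= xy.
have : mdist x y <= Delta.
  by apply: (mdist_cluster _ rG _ w x y bG); rewrite xy; exact: cluster_of_self.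
by rewrite leNgt Dxy.
Qed.

End moduli.

(** The quantitative form of the extension, from partitions with a common
    separation constant at all scales. *)
Lemma ext_modulus_le_separating (R : realType) (M : metricType R) (A : set M)
    (a0 : set_type A) (Z : completeNormedModType R) (L sigma : R) :
    0 < L -> 0 <= sigma ->
    (forall Delta, 0 < Delta -> has_separating_partition Delta sigma
      (set_type (closed_nbhd A (L^-1 * Delta)))) ->
  (ext_modulus A (norm_metric Z) <= (44 * (L + 1) + 10 * sigma)%:E)%E.
Proof.
move=> L0 sigma0 sepA; apply: ereal_inf_lbound.
exists (44 * (L + 1) + 10 * sigma) => //; split=> [|f foo]; first lra.
have [lam flam] : exists lam, lip_const f = lam%:E.
  exists (fine (lip_const f)); rewrite fineK// ge0_fin_numE//.
  exact: lip_const_ge0.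
have lam0 : 0 <= lam by rewrite -lee_fin -flam lip_const_ge0.
have flip : forall a b, `|(f a : Z) - (f b : Z)| <=
  lam * mdist (set_val a) (set_val b) := lip_constP _ _ f lam flam.
have k1 : 1 <= L + 1 by lra.
have Lk : L <= L + 1 by lra.
have /choice[G GP] : forall s, exists G : M -> Z, 0 < s ->
    (forall x c, dist_to A x < s ->
      `|G x - f c| <= lam * (3 * (L + 1) * s + mdist x (set_val c))) /\
    (forall x y, dist_to A x < s -> dist_to A y < s ->
      mdist x y <= s -> `|G x - G y| <= 10 * sigma * lam * mdist x y).
  move=> s; have [s0|_] := ltP 0 s; last by exists (fun=> 0).
  have [G GP] := scale_map A a0 L sigma L0 sepA Z f lam (L + 1) s
    lam0 k1 Lk sigma0 s0 flip.
  by exists G.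
have [F [Ff Flip]] := glue_scales _ _ A a0 Z f lam (L + 1) sigma G lam0 k1
  sigma0 flip (fun s x c s0 => (GP s s0).1 x c)
  (fun s x y s0 => (GP s s0).2 x y).
exists F; split=> //; rewrite flam -EFinM; apply: lip_const_le.
  by rewrite mulr_ge0//; lra.
by move=> x y; rewrite [_ * lam]mulrC; exact: Flip.
Qed.

Lemma ext_modulus_subsingleton (R : realType) (M T : metricType R)
    (A : set M) (a0 : set_type A) (K : R) :
    0 < K -> (forall a : set_type A, a = a0) ->
  (ext_modulus A T <= K%:E)%E.
Proof.
move=> K0 Aa; apply: ereal_inf_lbound; exists K => //; split=> // f _.
exists (fun=> f a0); split=> [a|]; first by rewrite (Aa a).
apply: (@le_trans _ _ 0%E); last first.
  by rewrite mule_ge0 ?lip_const_ge0// lee_fin ltW.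
by apply: lip_const_le => // x y; rewrite mdistxx mul0r.
Qed.

Theorem theorem1p13 (R : realType) :
  exists C : R, 0 < C /\
    forall (M : metricType R) (A : set M),
      A !=set0 ->
      (* local compactness of A in its own topology: locally_compact A would
         only ask for compact subsets of M *)
      locally_compact [set: set_type A] ->
      forall (Z : completeNormedModType R) (L : R), 0 < L ->
        (ext_modulus A (norm_metric Z) <=
         C%:E * (L%:E + ereal_sup
           [set separation_modulus Delta (set_type (closed_nbhd A (L^-1 * Delta)%R))
             | Delta in [set Delta : R | (0 < Delta)%R]]))%E.
Proof.
exists 120; split=> // M A [a Aa] _ Z L L0.
pose a0 : set_type A := SigSub (mem_set Aa).
set S := ereal_sup _.
have SE Delta : 0 < Delta -> (separation_modulus Delta
    (set_type (closed_nbhd A (L^-1 * Delta))) <= S)%E.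
  by move=> D0; apply: ereal_sup_ubound; exists Delta.
have S0 : (0 <= S)%E.
  exact: le_trans (separation_modulus_ge0 _ _) (SE 1 ltr01).
case: S S0 SE => [r| |//]; last first.
  by move=> _ _; rewrite addey// gt0_muley// leey.
rewrite lee_fin => r0 SE.
have sep Delta e : 0 < Delta -> 0 < e -> has_separating_partition Delta (r + e)
    (set_type (closed_nbhd A (L^-1 * Delta))).
  move=> D0 e0; apply: separation_modulus_lt => //.
  by rewrite (le_lt_trans (SE _ D0))// lte_fin ltrDl.
(* If A is a point, r may be 0, and f extends to a constant map. *)
have [[b ba]|Asub] := pselect (exists b, b <> a0); last first.
  apply: (ext_modulus_subsingleton _ _ _ _ a0); first by lra.
  by move=> b; apply: contrapT => ba; apply: Asub; exists b.
(* Two points of A at distance d are separated at the scale d / 2. *)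
have r12 : 1 / 2 <= r.
  apply/ler_addgt0Pr => e e0.
  have d0 : 0 < mdist (set_val a0) (set_val b).
    by rewrite mdist_gt0; apply/eqP => /val_inj ab; exact: ba.
  set d := mdist _ _ in d0.
  have d20 : 0 < d / 2 by lra.
  have mem (c : set_type A) : closed_nbhd A (L^-1 * (d / 2)) (set_val c).
    apply: (mem_closed_nbhd A _ c).
    by rewrite mdistxx mulr_ge0 ?invr_ge0 ?ltW.
  pose u (c : set_type A) : set_type (closed_nbhd A (L^-1 * (d / 2))) :=
    SigSub (mem_set (mem c)).
  have := separating_ge (d / 2) (r + e) _ (u a0) (u b) _ (sep _ _ d20 e0).
  rewrite [mdist _ _](_ : _ = d)//.
  have -> : (r + e) / (d / 2) * d = 2 * (r + e) by field; rewrite gt_eqF.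
  by move=> /(_ _); lra.
have sigma0 : 0 <= r + 1 by lra.
apply: le_trans (ext_modulus_le_separating _ _ _ a0 Z L (r + 1) L0 sigma0 _) _.
  by move=> Delta D0; exact: sep.
(* 44 (L + 1) + 10 (r + 1) <= 44 L + 118 r, as 1 <= 2 r. *)
by rewrite -EFinD -EFinM lee_fin; lra.
Qed.
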